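(* Let $M$ be a $C^\infty$ real hypersurface in $\mathbb{C}^n$ and let $p\in M$. Suppose $\Delta_1^{\mathrm{reg}}(M,p)<\infty$. Then the following two conditions are equivalent: (i) $\Delta_1(M,p)=\Delta_1^{\mathrm{reg}}(M,p)$; (ii) there exists a holomorphic coordinate $(z)$ at $p$ (with $p=0$) such that $\Delta_1(M,p)=\rho_1(M,p;(z))$.
   Context: A local defining function for $M$ near $p$ is a real-valued $C^\infty$ function $r$ near $p$ with $M=\{r=0\}$ near $p$ and $\nabla r\neq 0$ on $r=0$. For a $C^\infty$ map $h$ near $0\in\mathbb{C}$ with values in $\mathbb{C}$ or $\mathbb{C}^n$ and $h(0)=0$, $\mathrm{ord}(h)$ is the order of vanishing of $h$ at $0$ (the smallest total degree in $t,\bar t$ of a nonzero Taylor term; the minimum over components for vector-valued maps; $\infty$ if all derivatives vanish at $0$). Let $\Gamma$ be the set of germs of holomorphic maps $\gamma:(\mathbb{C},0)\to(\mathbb{C}^n,p)$ with $\gamma\not\equiv p$, and $\Gamma_{\mathrm{reg}}\subset\Gamma$ those with $\mathrm{ord}(\gamma-p)=1$. The singular type and regular type of $M$ at $p$ are $$\Delta_1(M,p)=\sup_{\gamma\in\Gamma}\frac{\mathrm{ord}(r\circ\gamma)}{\mathrm{ord}(\gamma-p)},\qquad \Delta_1^{\mathrm{reg}}(M,p)=\sup_{\gamma\in\Gamma_{\mathrm{reg}}}\mathrm{ord}(r\circ\gamma).$$ For a germ $F$ of a $C^\infty$ function at $0\in\mathbb{C}^n$ with Taylor series $\sum C_{\alpha\beta}z^\alpha\bar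 z^\beta$ ($\alpha,\beta\in\mathbb{Z}_{\ge0}^n$), the Newton polyhedron $\mathcal{N}_+(F)$ is the convex hull of $\bigcup\{\alpha+\beta+\mathbb{R}_{\ge0}^n: C_{\alpha\beta}\ne0\}$ in $\mathbb{R}^n$ (coordinates $\xi_1,\dots,\xi_n$). Put $\rho_j(F)=\min\{\xi_j>0:(0,\dots,\xi_j,\dots,0)\in\mathcal{N}_+(F)\}$ ($j$-th slot), and $\rho_j(F)=\infty$ if $\mathcal{N}_+(F)$ does not meet the $\xi_j$-axis. $F$ is convenient if $\mathcal{N}_+(F)$ meets every coordinate axis. For a holomorphic coordinate $(z)=(z_1,\dots,z_n)$ around $p$ with $p=0$, and a local defining function $r$ of $M$ written in the coordinate $(z)$, set $\rho_1(M,p;(z))=\max\{\rho_j(r):j=1,\dots,n\}$ if $r$ is convenient and $\rho_1(M,p;(z))=\infty$ otherwise (this is independent of the choice of $r$). *)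

(* Defs.v *)
From HB Require Import structures.
From mathcomp Require Import all_boot all_order all_algebra.
From mathcomp Require Import all_classical all_reals all_analysis.
From mathcomp Require Import complex.

Set Implicit Arguments.
Unset Strict Implicit.
Unset Printing Implicit Defensive.

Import Order.TTheory GRing.Theory Num.Theory.
Import numFieldNormedType.Exports.

Local Open Scope classical_set_scope.
Local Open Scope complex_scope.
Local Open Scope ring_scope.

(* R[i] with the topology and norm of its modulus, so that [differentiable]
   and ['D_v f] between spaces over R[i] are taken over the complex numbers. *)
HB.instance Definition _ (R : realType) := NormedModule.copy R[i] R[i]^o.

Section RealDerivatives.
Variables (R : realType) (V : lmodType R[i]).

Definition real_line (z v : V) (s : R) : V := z + s%:C *: v.

Definition rderiv (v : V) (f : V -> R) (z : V) : R :=
  derive1 (f \o real_line z v) 0.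

Definition cderiv (v : V) (f : V -> R[i]) (z : V) : R[i] :=
  (rderiv v (fun x => complex.Re (f x)) z) +i* (rderiv v (fun x => complex.Im (f x)) z).

(* Wirtinger derivatives d/dz_v = (d/dx - i d/dy)/2 and
   d/dzbar_v = (d/dx + i d/dy)/2 along the complex line spanned by v, the
   real coordinates x and y having directions v and iv. *)
Definition wirtinger (v : V) (f : V -> R[i]) (z : V) : R[i] :=
  2^-1 * (cderiv v f z - 'i * cderiv ('i *: v) f z).

Definition wirtinger_bar (v : V) (f : V -> R[i]) (z : V) : R[i] :=
  2^-1 * (cderiv v f z + 'i * cderiv ('i *: v) f z).

End RealDerivatives.

(* Holomorphic near x, with the usual convention of several complex variables:
   f is C^1 and satisfies the Cauchy-Riemann equations, i.e. its differential
   is complex linear. *)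
Definition holomorphic_near (R : realType) (V W : normedModType R[i])
    (f : V -> W) (x : V) : Prop :=
  \forall y \near x, differentiable f y /\
    forall v, {for y, continuous (fun u => 'D_v f u)}.

Section OneVariable.
Variable R : realType.

(* Coefficient of t^a tbar^b in the Taylor series of h at 0. *)
Definition taylor_coef1 (h : R[i] -> R[i]) (a b : nat) : R[i] :=
  iter a (wirtinger (1 : R[i])) (iter b (wirtinger_bar (1 : R[i])) h) 0
  / (a`! * b`!)%:R.

Definition ord (h : R[i] -> R[i]) : \bar R :=
  ereal_inf [set ((ab.1 + ab.2)%N%:R)%:E | ab in
              [set ab : nat * nat | taylor_coef1 h ab.1 ab.2 != 0]].

Definition vord (n : nat) (h : R[i] -> 'rV[R[i]]_n) : \bar R :=
  ereal_inf [set ord (fun t => h t 0 j) | j in [set: 'I_n]].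

End OneVariable.

Section SeveralVariables.
Variables (R : realType) (n : nat).
Notation Cn := 'rV[R[i]]_n.

Definition basis_vec (j : 'I_n) : Cn := delta_mx 0 j.

(* Directions of the 2n real coordinates of C^n: (j, false) is x_j and
   (j, true) is y_j. *)
Definition real_dir (k : 'I_n * bool) : Cn :=
  if k.2 then 'i *: basis_vec k.1 else basis_vec k.1.

Definition partials (s : seq ('I_n * bool)) (f : Cn -> R) : Cn -> R :=
  foldr (fun k g => rderiv (real_dir k) g) f s.

(* C^oo near p: on one neighbourhood of p all iterated real partial
   derivatives exist and are continuous. *)
Definition smooth_near (p : Cn) (f : Cn -> R) : Prop :=
  \forall z \near p, forall s : seq ('I_n * bool),
    {for z, continuous (partials s f)} /\
    forall k, derivable (partials s f \o real_line z (real_dir k)) 0 1.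

Definition local_defining (M : set Cn) (p : Cn) (r : Cn -> R) : Prop :=
  [/\ smooth_near p r,
      \forall z \near p, M z <-> r z = 0 &
      \forall z \near p, r z = 0 ->
        exists k, rderiv (real_dir k) r z != 0].

Definition real_hypersurface (M : set Cn) : Prop :=
  forall q, M q -> exists r, local_defining M q r.

Definition holomorphic_curves (p : Cn) : set (R[i] -> Cn) :=
  [set g | [/\ holomorphic_near g 0,
               g 0 = p &
               ~ (\forall t \near (0 : R[i]), g t = p)]].

Definition regular_curves (p : Cn) : set (R[i] -> Cn) :=
  [set g | holomorphic_curves p g /\ vord (fun t => g t - p) = 1%E].

Definition contact (r : Cn -> R) (g : R[i] -> Cn) : \bar R :=
  ord (fun t => (r (g t))%:C).

Definition singular_type (r : Cn -> R) (p : Cn) : \bar R :=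
  ereal_sup [set (contact r g / vord (fun t => (g t - p)%R))%E |
              g in holomorphic_curves p].

Definition regular_type (r : Cn -> R) (p : Cn) : \bar R :=
  ereal_sup [set contact r g | g in regular_curves p].

(* Coefficient of z^alpha zbar^beta in the Taylor series of F at 0. *)
Definition taylor_coef (F : Cn -> R[i]) (alpha beta : 'I_n -> nat) : R[i] :=
  foldr (fun j g => iter (alpha j) (wirtinger (basis_vec j)) g)
    (foldr (fun j g => iter (beta j) (wirtinger_bar (basis_vec j)) g)
       F (enum 'I_n))
    (enum 'I_n) 0
  / (\prod_j ((alpha j)`! * (beta j)`!))%:R.

Definition newton_polyhedron (F : Cn -> R[i]) : set 'rV[R]_n :=
  smallest (@convex_set R 'rV[R]_n)
    [set xi : 'rV[R]_n | exists alpha beta : 'I_n -> nat,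
       taylor_coef F alpha beta != 0 /\
       forall j, (alpha j + beta j)%:R <= xi 0 j].

Definition axis_pt (j : 'I_n) (x : R) : 'rV[R]_n := x *: delta_mx 0 j.

(* +oo when the polyhedron misses the j-th axis, as the infimum of set0;
   otherwise a minimum as soon as F 0 = 0. *)
Definition rho (F : Cn -> R[i]) (j : 'I_n) : \bar R :=
  ereal_inf [set x%:E | x in
              [set x : R | 0 < x /\ newton_polyhedron F (axis_pt j x)]].

Definition convenient (F : Cn -> R[i]) : Prop :=
  forall j, exists x, newton_polyhedron F (axis_pt j x).

Definition max_rho (F : Cn -> R[i]) : \bar R :=
  if `[< convenient F >] then \big[maxe/-oo%E]_(j < n) rho F j else +oo%E.

(* z : (C^n, p) -> (C^n, 0) is a local biholomorphism with local inverse w. *)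
Definition holomorphic_coordinate (p : Cn) (z w : Cn -> Cn) : Prop :=
  [/\ z p = 0 /\ w 0 = p,
      holomorphic_near z p,
      holomorphic_near w 0,
      \forall x \near p, w (z x) = x &
      \forall y \near (0 : Cn), z (w y) = y].

(* r written in the coordinate with local inverse w is r o w. *)
Definition rho1 (r : Cn -> R) (w : Cn -> Cn) : \bar R :=
  max_rho (fun y => (r (w y))%:C).

End SeveralVariables.

(* Main.v *)
(* The jth axis meets the Newton polyhedron of r o w exactly above the pure
   Taylor terms in z_j, so rho_j is the order of contact of r with the curve
   t |-> w(t e_j).  This curve is regular for every holomorphic coordinate, hence
   rho_1 <= Delta_1^reg <= Delta_1, which gives (ii) => (i).  Conversely the
   supremum Delta_1^reg of a bounded set of natural numbers is attained by some
   regular curve g, with g_k'(0) != 0 say, and the coordinate whose inverse is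
   w(y) = y + g(y_k) - y_k e_k has g as its kth axis; then rho_1 = Delta_1^reg.
   Inverting w only requires the C^1 inverse function theorem in one complex
   variable, so no power series expansion of holomorphic maps is involved. *)
Require Import Defs.
From HB Require Import structures.
From mathcomp Require Import all_boot all_order all_algebra.
From mathcomp Require Import all_classical all_reals all_analysis.
From mathcomp Require Import complex ring lra.

Set Implicit Arguments.
Unset Strict Implicit.
Unset Printing Implicit Defensive.

Import Order.TTheory GRing.Theory Num.Theory.
Import numFieldNormedType.Exports.

Local Open Scope classical_set_scope.
Local Open Scope complex_scope.
Local Open Scope ring_scope.

(** * Continuity and size of real and imaginary parts *)

Section ComplexTopology.
Variable R : realType.

Lemma Re_continuous : continuous (fun z : R[i] => complex.Re z).
Proof.
move=> z; apply/(@cvgrPdist_lt _ _ _ (nbhs z)) => e e0; apply/nbhs_ballP.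
exists e%:C => [|u /= zu]; first by rewrite /= ltcR.
by rewrite -ltcR -raddfB; apply: le_lt_trans (normc_ge_Re _) _.
Qed.

Lemma ReNiE (z : R[i]) : complex.Re (- ('i * z)) = complex.Im z.
Proof. by case: z => a b /=; rewrite mul0r mul1r sub0r opprK. Qed.

Lemma normci : `|'i : R[i]| = 1.
Proof. by rewrite normc_def/= expr0n expr1n add0r sqrtr1. Qed.

Lemma normc_ge_Im (x : R[i]) : `|complex.Im x|%:C <= `|x|.
Proof.
rewrite -ReNiE; apply: le_trans (normc_ge_Re _) _.
by rewrite normrN normrM normci mul1r.
Qed.

Lemma Im_continuous : continuous (fun z : R[i] => complex.Im z).
Proof.
move=> z; apply/(@cvgrPdist_lt _ _ _ (nbhs z)) => e e0; apply/nbhs_ballP.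
exists e%:C => [|u /= zu]; first by rewrite /= ltcR.
by rewrite -ltcR -raddfB; apply: le_lt_trans (normc_ge_Im _) _.
Qed.

Lemma normc_real (s : R) : `|s%:C| = `|s|%:C.
Proof. by rewrite normc_def /= expr0n/= addr0 sqrtr_sqr. Qed.

Lemma normc_le_ReIm (z : R[i]) :
  `|z| <= `|complex.Re z|%:C + `|complex.Im z|%:C.
Proof.
rewrite {1}[z]complexE; apply: le_trans (ler_normD _ _) _.
by rewrite normrM normci mul1r !normc_real.
Qed.

(** The embedding of the reals is isometric and injective, so a limit of complex difference
    quotients restricts to real increments. *)
Lemma real_complex_cvg_dnbhs : (fun s : R => s%:C) @ 0^' --> (0 : R[i])^'.
Proof.
move=> A /= [e /=]; rewrite ltcE /= => /andP[/eqP ime e0] eA.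
exists (complex.Re e) => //= s /= es s0; apply: eA => /=.
  move: es; rewrite !sub0r !normrN => es.
  by rewrite normc_real ltcE /= ime eqxx.
by rewrite (inj_eq (@complexI R)).
Qed.

End ComplexTopology.

(** * Real directional, complex and Wirtinger derivatives *)

Section RealLines.
Variables (R : realType) (V : normedModType R[i]).

(** [L] is continuous and real linear, so it commutes with the difference quotient for real
    increments. Stated once to serve both the real and the imaginary part. *)
Lemma is_derive_real_line (L : R[i] -> R) (f : V -> R[i]) (z v : V) (s : R) :
  continuous L -> {morph L : x y / x - y} ->
  (forall (t : R) w, L (t%:C * w) = t * L w) ->
  derivable f (real_line z v s) v ->
  is_derive s 1 (fun t => L (f (real_line z v t)))
    (L ('D_v f (real_line z v s))).
Proof.
move=> Lc LB LZ df.
have quotE (t : R) :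
    t^-1 *: (L (f (real_line z v (t *: 1 + s))) - L (f (real_line z v s))) =
    L (t%:C^-1 *: (f (t%:C *: v + real_line z v s) - f (real_line z v s))).
  rewrite /real_line -(fmorphV (real_complex R)) LZ LB; congr (_ * (L (f _) - _)).
  by rewrite [t *: 1]mulr1 rmorphD scalerDl addrCA.
suff H : (fun t : R => t^-1 *: (L (f (real_line z v (t *: 1 + s))) -
    L (f (real_line z v s)))) @ 0^' --> L ('D_v f (real_line z v s)).
  by split; [apply/cvg_ex; eexists; exact: H | exact: cvg_lim H].
under eq_fun do rewrite quotE.
pose q (h : R[i]) := h^-1 *: (f (h *: v + real_line z v s) - f (real_line z v s)).
apply: (@cvg_comp _ _ _ (fun t : R => q t%:C) L); last exact: Lc.
exact: (@cvg_comp _ _ _ _ q _ _ _ (@real_complex_cvg_dnbhs R) df).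
Qed.

Lemma is_derive_Re_real_line (f : V -> R[i]) (z v : V) (s : R) :
  derivable f (real_line z v s) v ->
  is_derive s 1 (fun t => complex.Re (f (real_line z v t)))
    (complex.Re ('D_v f (real_line z v s))).
Proof.
apply: is_derive_real_line => [||t [a b] /=]; first exact: Re_continuous.
- exact: raddfB.
- by rewrite mul0r subr0.
Qed.

Lemma is_derive_Im_real_line (f : V -> R[i]) (z v : V) (s : R) :
  derivable f (real_line z v s) v ->
  is_derive s 1 (fun t => complex.Im (f (real_line z v t)))
    (complex.Im ('D_v f (real_line z v s))).
Proof.
apply: is_derive_real_line => [||t [a b] /=]; first exact: Im_continuous.
- exact: raddfB.
- by rewrite mul0r addr0.
Qed.

Lemma real_line0 (z v : V) : real_line z v 0 = z.
Proof. by rewrite /real_line rmorph0 scale0r addr0. Qed.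

Lemma cderivE (f : V -> R[i]) (z v : V) :
  derivable f z v -> cderiv v f z = 'D_v f z.
Proof.
rewrite -{1}(real_line0 z v) => df.
rewrite /cderiv /rderiv !derive1E.
have -> := derive_val (is_derive := is_derive_Re_real_line df).
have -> := derive_val (is_derive := is_derive_Im_real_line df).
by rewrite real_line0; case: ('D_v f z).
Qed.

Lemma derive_scale (W : normedModType R[i]) (f : V -> W) (z v : V) (c : R[i]) :
  differentiable f z -> 'D_(c *: v) f z = c *: 'D_v f z.
Proof. by move=> df; rewrite !deriveE// linearZ. Qed.

(** Complex linearity of the differential turns the derivative along ['i *: v] into ['i] times the
    one along [v]; the two terms then add up here and cancel in the conjugate operator below. *)
Lemma wirtinger_holomorphic (f : V -> R[i]) (z v : V) :
  differentiable f z -> wirtinger v f z = 'D_v f z.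
Proof.
move=> df; rewrite /wirtinger !cderivE; [|exact: diff_derivable..].
rewrite derive_scale// /GRing.scale/= mulrA -expr2 sqr_i mulN1r opprK.
by rewrite -[X in _ * X]mulr2n -[X in _ * X]mulr_natl mulKf// pnatr_eq0.
Qed.

Lemma wirtinger_bar_holomorphic (f : V -> R[i]) (z v : V) :
  differentiable f z -> wirtinger_bar v f z = 0.
Proof.
move=> df; rewrite /wirtinger_bar !cderivE; [|exact: diff_derivable..].
by rewrite derive_scale// /GRing.scale/= mulrA -expr2 sqr_i mulN1r subrr mulr0.
Qed.

End RealLines.

(** * A mean value inequality in one complex variable *)

Section MeanValue.
Variable R : realType.
Implicit Types (f : R[i] -> R[i]) (x y a m : R[i]).

Lemma derive_along (W : normedModType R[i]) (h : R[i] -> W) (z v : R[i]) :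
  differentiable h z -> 'D_v h z = v *: 'D_1 h z.
Proof.
by move=> dh; have := derive_scale (1 : R[i]) v dh; rewrite [v *: 1]mulr1 => ->.
Qed.

Lemma mean_value_real (F : R -> R) (dF : R -> R) (m : R) :
  (forall s : R, 0 <= s <= 1 -> is_derive s 1 F (dF s)) ->
  (forall s : R, 0 <= s <= 1 -> `|dF s| <= m) ->
  `|F 1 - F 0| <= m.
Proof.
move=> dFF dFm.
have [|||c c01 ->] := @MVT _ F dF 0 1.
- exact: ltr01.
- by move=> s /[!in_itv] /andP[s0 s1]; apply: dFF; rewrite !ltW.
- apply: derivable_within_continuous => s /[!in_itv] /= s01.
  by case: (dFF s s01).
move: c01; rewrite in_itv/= => /andP[c0 c1].
by rewrite subr0 mulr1 dFm// !ltW.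
Qed.

(* The factor 2 comes from applying the real mean value theorem to the real and
   imaginary parts separately. *)
Lemma mean_value_complex f x y a m :
  (forall s : R, 0 <= s <= 1 -> differentiable f (real_line y (x - y) s) /\
     `|'D_1 f (real_line y (x - y) s) - a| <= m) ->
  `|f x - f y - a * (x - y)| <= 2 * m * `|x - y|.
Proof.
move=> H; pose v : R[i] := x - y.
(* Removing the linear part leaves a function whose derivative on the segment is bounded by [m]. *)
pose G (u : R[i]) : R[i] := f u - a * u.
have dG s : 0 <= s <= 1 -> is_derive (real_line y v s) v G
    (v * ('D_1 f (real_line y v s) - a)).
  move=> /H[df _].
  have -> : v * ('D_1 f (real_line y v s) - a) =
      'D_v f (real_line y v s) - a *: v.
    by rewrite mulrBr [a *: v]mulrC (derive_along v df).
  by apply: is_deriveB; exact/derivableP/diff_derivable.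
have GE : f x - f y - a * (x - y) = G x - G y.
  by rewrite /G mulrBr !opprB addrACA [RHS]addrACA [- f y + _]addrC.
have m0 : 0 <= m.
  by have [] := H 0 _; [rewrite lexx ler01|move=> _; apply: le_trans].
have rl0 : real_line y v 0 = y by exact: real_line0.
have rl1 : real_line y v 1 = x by rewrite /real_line scale1r addrC subrK.
(* The bound [m] is a nonnegative element of [R[i]]; the mean value theorem on the real line needs
   it as an element of [R]. *)
pose M := complex.Re (m * `|v|).
have ME : M%:C = m * `|v| by rewrite RRe_real// ger0_real// mulr_ge0.
have dGM s : 0 <= s <= 1 -> `|'D_v G (real_line y v s)| <= M%:C.
  move=> s01; rewrite ME (derive_val (is_derive := dG s s01)) normrM mulrC.
  by apply: ler_wpM2r => //; have [] := H s s01.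
have ReG : `|complex.Re (G x) - complex.Re (G y)| <= M.
  rewrite -{1}rl1 -{2}rl0.
  apply: (@mean_value_real (fun s => complex.Re (G (real_line y v s)))
    (fun s => complex.Re ('D_v G (real_line y v s)))) => s s01.
    by apply: is_derive_Re_real_line; case: (dG s s01).
  by rewrite -lecR; apply: le_trans (normc_ge_Re _) (dGM s s01).
have ImG : `|complex.Im (G x) - complex.Im (G y)| <= M.
  rewrite -{1}rl1 -{2}rl0.
  apply: (@mean_value_real (fun s => complex.Im (G (real_line y v s)))
    (fun s => complex.Im ('D_v G (real_line y v s)))) => s s01.
    by apply: is_derive_Im_real_line; case: (dG s s01).
  by rewrite -lecR; apply: le_trans (normc_ge_Im _) (dGM s s01).
rewrite GE -mulrA -ME mulr_natl mulr2n.
apply: le_trans (normc_le_ReIm _) _.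
by apply: lerD; rewrite lecR [X in `|X|](raddfB _ (G x)).
Qed.

End MeanValue.

(** * The real-valued modulus and compact squares in the plane *)

Section LocalInverse.
Variable R : realType.
Implicit Types x y z : R[i].

(** The norm on [R[i]] takes values in [R[i]], which is only partially ordered; the real-valued copy
    gives access to minima over compact sets and to real arithmetic. *)
Definition modulus z : R := complex.Re `|z|.

Lemma modulusE z : (modulus z)%:C = `|z|.
Proof. exact/RRe_real/normr_real. Qed.

Lemma modulus0 : modulus 0 = 0.
Proof. by rewrite /modulus normr0. Qed.

Lemma modulusN z : modulus (- z) = modulus z.
Proof. by rewrite /modulus normrN. Qed.

Lemma modulusC x y : modulus (x - y) = modulus (y - x).
Proof. by rewrite -modulusN opprB. Qed.

Lemma modulusM x y : modulus (x * y) = modulus x * modulus y.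
Proof. by apply: (@complexI R); rewrite rmorphM !modulusE normrM. Qed.

Lemma modulusD x y : modulus (x + y) <= modulus x + modulus y.
Proof. by rewrite -lecR rmorphD !modulusE ler_normD. Qed.

Lemma modulus_gt0 z : (0 < modulus z) = (z != 0).
Proof. by rewrite -ltcR modulusE normr_gt0. Qed.

Lemma modulus_ge0 z : 0 <= modulus z.
Proof. by rewrite -lecR modulusE normr_ge0. Qed.

Lemma modulus_eq0 z : modulus z = 0 -> z = 0.
Proof. by move=> z0; apply/eqP; rewrite -normr_eq0 -modulusE z0. Qed.

Lemma ler_norm_Re z : `|complex.Re z| <= modulus z.
Proof. by rewrite -lecR modulusE normc_ge_Re. Qed.

Lemma ler_norm_Im z : `|complex.Im z| <= modulus z.
Proof. by rewrite -lecR modulusE normc_ge_Im. Qed.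

Lemma modulus_le_ReIm z : modulus z <= `|complex.Re z| + `|complex.Im z|.
Proof. by rewrite -lecR rmorphD modulusE normc_le_ReIm. Qed.

Lemma modulus_near (z : R[i]) (e : R) : 0 < e -> \forall x \near z, modulus (x - z) < e.
Proof.
move=> e0; apply/nbhs_ballP; exists e%:C => [|u /= zu]; first by rewrite /= ltcR.
by rewrite modulusC -ltcR modulusE.
Qed.

(** A positive element of [R[i]] has zero imaginary part, so its real part serves as the radius. *)
Lemma near_modulusP (z : R[i]) (P : set R[i]) :
  (\forall x \near z, P x) ->
  exists2 e : R, 0 < e & forall x, modulus (x - z) < e -> P x.
Proof.
move=> /nbhs_ballP[e /=]; rewrite ltcE /= => /andP[/eqP ime e0] eP.
exists (complex.Re e) => // x xz; apply: eP.
by rewrite -ball_normE /= -modulusE modulusC ltcE /= ime eqxx.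
Qed.

Lemma continuous_complex_of_pair (w : R[i]) :
  continuous (fun u : R * R => w + (u.1%:C + 'i * u.2%:C)).
Proof.
move=> u; apply/cvgrPdist_lt => e; rewrite ltcE /= => /andP[/eqP ime e0].
have e2 : 0 < complex.Re e / 2 by exact: divr_gt0.
have u1 : \forall v \near u, `|u.1 - v.1| < complex.Re e / 2.
  by apply: (@cvgr_dist_lt R R _ (nbhs u) _ fst u.1) => //; exact: cvg_fst.
have u2 : \forall v \near u, `|u.2 - v.2| < complex.Re e / 2.
  by apply: (@cvgr_dist_lt R R _ (nbhs u) _ snd u.2) => //; exact: cvg_snd.
apply: filterS2 u1 u2 => v uv1 uv2.
rewrite -modulusE ltcE /= ime eqxx /=.
apply: le_lt_trans (modulus_le_ReIm _) _.
have -> : w + (u.1%:C + 'i * u.2%:C) - (w + (v.1%:C + 'i * v.2%:C)) =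
    (u.1 - v.1) +i* (u.2 - v.2).
  rewrite opprD addrACA subrr add0r opprD addrACA -rmorphB -mulrBr.
  by rewrite [RHS]complexE /=; congr (_ + 'i * _); rewrite rmorphB.
by rewrite [ltRHS]splitr ltrD.
Qed.

(** The square is the continuous image of a product of two real segments, which reduces compactness
    to the real line. *)
Lemma compact_square (w : R[i]) (d : R) :
  compact [set z | `|complex.Re (z - w)| <= d /\ `|complex.Im (z - w)| <= d].
Proof.
rewrite (_ : mkset _ = (fun u : R * R => w + (u.1%:C + 'i * u.2%:C)) @`
    (`[- d, d] `*` `[- d, d])).
  apply: continuous_compact; last by apply: compact_setX; exact: segment_compact.
  exact/continuous_subspaceT/continuous_complex_of_pair.
apply/seteqP; split => [z [zre zim]|_ [[s t] /= [sd td] <-]] /=.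
  exists (complex.Re (z - w), complex.Im (z - w)) => /=.
    by split; rewrite in_itv /= -ler_norml.
  by rewrite -complexE addrC subrK.
move: sd td; rewrite !in_itv /= -!ler_norml addrC addKr.
set q := _ + _.
have -> : q = s +i* t by rewrite [RHS]complexE.
by [].
Qed.

End LocalInverse.

(** * Quantitative inverse function theorem in one complex variable *)

Section InverseFunction.
Variable R : realType.
Implicit Types (f : R[i] -> R[i]) (x y a : R[i]) (d : R).

(** Convexity of discs: it keeps the segment of the mean value inequality inside the disc where the
    derivative is controlled. *)
Lemma modulus_real_line (x0 x y : R[i]) (s e : R) :
  0 <= s <= 1 -> modulus (x - x0) < e -> modulus (y - x0) < e ->
  modulus (real_line y (x - y) s - x0) < e.
Proof.
move=> /andP[s0 s1] xe ye.
have -> : real_line y (x - y) s - x0 = s%:C * (x - x0) + (1 - s)%:C * (y - x0).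
  have -> : (1 - s)%:C = 1 - s%:C :> R[i] by rewrite rmorphB rmorph1.
  have -> : real_line y (x - y) s = y + s%:C * (x - y) by [].
  by set c := s%:C; ring.
apply: le_lt_trans (modulusD _ _) _; rewrite !modulusM.
have -> : modulus s%:C = s by rewrite /modulus normc_real /= ger0_norm.
have -> : modulus (1 - s)%:C = 1 - s.
  by rewrite /modulus normc_real /= ger0_norm// subr_ge0.
have m_lt : Num.max (modulus (x - x0)) (modulus (y - x0)) < e by rewrite gt_max xe ye.
apply: le_lt_trans m_lt; set m := Num.max _ _.
have : modulus (x - x0) <= m by rewrite le_max lexx.
have : modulus (y - x0) <= m by rewrite le_max lexx orbT.
by nra.
Qed.

(** Continuity of the derivative makes [f] nearly linear on a small disc. The radius is written
    [5 * d] so that the disc contains the square of half-side [2 * d] used for surjectivity. *)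
Lemma linear_approximation f x0 :
  holomorphic_near f x0 -> 'D_1 f x0 != 0 ->
  exists d, [/\ 0 < d,
    forall x, modulus (x - x0) < 5 * d ->
      [/\ differentiable f x, {for x, continuous ('D_1 f)} & 'D_1 f x != 0] &
    forall x y, modulus (x - x0) < 5 * d -> modulus (y - x0) < 5 * d ->
      modulus (f x - f y - 'D_1 f x0 * (x - y)) <=
      modulus ('D_1 f x0) / 2 * modulus (x - y)].
Proof.
move=> hf; set a := 'D_1 f x0 => a0.
have [e1 e1_gt0 H1] := near_modulusP hf.
have ma : 0 < modulus a by rewrite modulus_gt0.
have c0 : {for x0, continuous ('D_1 f)} by exact: (nbhs_singleton hf).2.
(* A quarter, because the mean value inequality doubles the bound; it also keeps the derivative away
   from 0. *)
have : \forall x \near x0, modulus ('D_1 f x - a) < modulus a / 4.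
  by apply: (c0 [set w | modulus (w - a) < modulus a / 4]); apply: modulus_near; lra.
move=> /near_modulusP[e2 e2_gt0 H2].
pose d := Num.min e1 e2 / 5.
have d0 : 0 < d by rewrite divr_gt0// lt_min e1_gt0.
have d5 : 5 * d = Num.min e1 e2 by rewrite /d; set m := Num.min _ _; field.
have near_d x : modulus (x - x0) < 5 * d ->
    [/\ differentiable f x, {for x, continuous ('D_1 f)} &
        modulus ('D_1 f x - a) < modulus a / 4].
  rewrite d5 lt_min => /andP[x1 x2].
  by have [df cf] := H1 _ x1; split; [exact: df|exact: cf|exact: H2].
exists d; split; [exact: d0|move=> x /near_d[df cf dfa]|move=> x y xd yd].
  split; [exact: df|exact: cf|apply/eqP => D0; move: dfa].
  by rewrite D0 sub0r modulusN => ?; lra.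
have := @mean_value_complex R f x y a (modulus a / 4)%:C.
rewrite -!modulusE -(rmorph_nat (real_complex R)) -!rmorphM lecR => H.
rewrite (_ : modulus a / 2 = 2 * (modulus a / 4)); last by field.
apply: H => s s01; have [df _ /ltW dfa] := near_d _ (modulus_real_line s01 xd yd).
by split => //; rewrite -modulusE lecR.
Qed.

Section Inverse.
Variables (f : R[i] -> R[i]) (x0 a : R[i]) (d : R).
Hypotheses (d0 : 0 < d) (a0 : a != 0).
Hypothesis fC : forall x, modulus (x - x0) < 5 * d -> {for x, continuous f}.
Hypothesis fa : forall x y, modulus (x - x0) < 5 * d -> modulus (y - x0) < 5 * d ->
  modulus (f x - f y - a * (x - y)) <= modulus a / 2 * modulus (x - y).

(** Reverse triangle inequality: the linear part has size [modulus a * modulus (x - y)] and the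
    error eats at most half of it. Injectivity and the continuity of the inverse both come from this
    bound. *)
Lemma lower_bound x y : modulus (x - x0) < 5 * d -> modulus (y - x0) < 5 * d ->
  modulus a / 2 * modulus (x - y) <= modulus (f x - f y).
Proof.
move=> xd yd; have H := fa xd yd.
have := modulusD (f x - f y) (a * (x - y) - (f x - f y)).
rewrite addrC subrK [X in _ <= _ + X]modulusC.
by rewrite modulusM => ?; lra.
Qed.

Lemma local_injective x y : modulus (x - x0) < 5 * d -> modulus (y - x0) < 5 * d ->
  f x = f y -> x = y.
Proof.
move=> xd yd fxy; have := lower_bound xd yd; rewrite fxy subrr modulus0.
have ma : 0 < modulus a by rewrite modulus_gt0.
move=> H; apply/eqP; rewrite -subr_eq0; apply/eqP/modulus_eq0.
by have := modulus_ge0 (x - y); nra.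
Qed.

(* At a minimum x of |f - y| over a compact square, the Newton step
   x - (f x - y) / a would halve |f - y| without leaving the square. *)
Lemma local_surjective y : modulus (y - f x0) < modulus a * d / 4 ->
  exists2 x, modulus (x - x0) < d & f x = y.
Proof.
move=> yd; have ma : 0 < modulus a by rewrite modulus_gt0.
have d_gt0 := d0.
(* The minimiser will lie within [d] of [x0] and the Newton step is shorter than [d / 4], so
   half-side [2 * d] leaves room for both. *)
pose K := [set z : R[i] |
  `|complex.Re (z - x0)| <= 2 * d /\ `|complex.Im (z - x0)| <= 2 * d].
have Kx0 : K x0 by rewrite /K /= subrr /= normr0; split; rewrite mulr_ge0// ltW.
have K5 z : K z -> modulus (z - x0) < 5 * d.
  by move=> [? ?]; have := modulus_le_ReIm (z - x0); lra.
have x0d : modulus (x0 - x0) < 5 * d by rewrite subrr modulus0; lra.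
have [||x xK xmin] := @compact_EVT_min _ R (fun z => modulus (f z - y)) K _
    (@compact_square R x0 (2 * d)).
- by exists x0.
- apply: continuous_in_subspaceT => z /[!inE] zK.
  apply: (@continuous_comp _ _ _ (fun z => `|f z - y|)); last exact: Re_continuous.
  apply: (@cvg_norm R[i] R[i] _ (nbhs z)).
  apply: (@cvgB R[i] R[i] _ (nbhs z) _ f (cst y)); last exact: cvg_cst.
  exact/fC/K5.
have {}xK := set_mem xK.
have {}xmin z : K z -> modulus (f x - y) <= modulus (f z - y).
  by move=> zK; apply: xmin; rewrite inE.
have ed : modulus (f x - y) < modulus a * d / 4.
  by apply: le_lt_trans (xmin _ Kx0) _; rewrite modulusC.
(* Both [f x] and [f x0] are within [modulus a * d / 4] of [y], and [lower_bound] divides their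
   distance by [modulus a / 2]. *)
have xd : modulus (x - x0) < d.
  have := lower_bound (K5 _ xK) x0d.
  have := modulusD (f x - y) (y - f x0); rewrite addrA subrK => ? ?.
  have : modulus a / 2 * modulus (x - x0) < modulus a / 2 * d by nra.
  by rewrite ltr_pM2l//; lra.
exists x => //; apply/eqP; rewrite -subr_eq0; apply/eqP/modulus_eq0.
pose x' := x - (f x - y) / a.
have ha : a * (x' - x) = - (f x - y).
  by rewrite /x' addrAC subrr add0r mulrN mulrCA divff// mulr1.
have hd : modulus (x' - x) < d / 4.
  have : modulus a * modulus (x' - x) < modulus a * (d / 4).
    by rewrite -modulusM ha modulusN; lra.
  by rewrite ltr_pM2l.
have x'd : modulus (x' - x0) <= 2 * d.
  by have := modulusD (x' - x) (x - x0); rewrite addrA subrK; lra.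
have x'K : K x'.
  by split; [apply: le_trans (ler_norm_Re _) _|apply: le_trans (ler_norm_Im _) _].
have := fa (K5 _ x'K) (K5 _ xK); rewrite ha opprK addrA subrK.
have := xmin _ x'K.
have : modulus a * modulus (x' - x) = modulus (f x - y).
  by rewrite -modulusM ha modulusN.
by have := modulus_ge0 (f x - y); nra.
Qed.

Definition local_inverse y : R[i] :=
  xget x0 [set x | modulus (x - x0) < d /\ f x = y].

Lemma local_inverseP y : modulus (y - f x0) < modulus a * d / 4 ->
  modulus (local_inverse y - x0) < d /\ f (local_inverse y) = y.
Proof.
move=> /local_surjective[x xd fx].
rewrite /local_inverse; case: xgetP => [z _ //|/(_ x)].
by move=> H; exfalso; apply: H.
Qed.

End Inverse.
End InverseFunction.

(** * Closure properties of holomorphic maps *)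

Section HolomorphicMaps.
Variable R : realType.
Implicit Types (U V W : normedModType R[i]).

Lemma derive_comp U V W (f : U -> V) (g : V -> W) (x v : U) :
  differentiable f x -> differentiable g (f x) ->
  'D_v (g \o f) x = 'D_('D_v f x) g (f x).
Proof.
move=> df dg; rewrite !deriveE//; last exact: differentiable_comp.
by rewrite diff_comp.
Qed.

Lemma is_diff_coord (n : nat) (k : 'I_n) (x : 'rV[R[i]]_n) :
  is_diff x (fun y => y 0 k) (fun y => y 0 k).
Proof.
have lin : linear (fun y : 'rV[R[i]]_n => y 0 k : R[i]).
  by move=> c u v; rewrite !mxE.
(* The coordinate function is repackaged as a linear map, so that the differential of a continuous
   linear map applies. *)
pose M := GRing.isLinear.Build _ _ _ _ _ lin.
pose L : {linear _ -> _} := HB.pack (fun y : 'rV[R[i]]_n => y 0 k : R[i]) M.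
have -> : (fun y : 'rV[R[i]]_n => y 0 k) = L by [].
apply: DiffDef; first exact/linear_differentiable/coord_continuous.
by rewrite diff_lin //; apply: coord_continuous.
Qed.

(** A formula [D] for the derivative valid on a neighbourhood of [x] is valid near each nearby point
    too, so continuity passes from [D v] to the derivative itself. The closure lemmas below only
    have to supply such a formula. *)
Lemma holomorphic_near_derive V W (h : V -> W) (D : V -> V -> W) (x : V) :
  (\forall y \near x, differentiable h y /\
    forall v, 'D_v h y = D v y /\ {for y, continuous (D v)}) ->
  holomorphic_near h x.
Proof.
move=> H; apply: filterS (near_join H) => y Hy.
have [dh hD] := nbhs_singleton Hy.
split=> [//|v]; have [DE Dc] := hD v.
rewrite /prop_for /continuous_at DE.
have DvE : \forall u \near y, D v u = 'D_v h u.
  by apply: filterS Hy => u [_ /(_ v)[-> _]].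
by apply: cvg_trans Dc; exact: near_eq_cvg DvE.
Qed.

Lemma holomorphicD V W (f g : V -> W) (x : V) :
  holomorphic_near f x -> holomorphic_near g x ->
  holomorphic_near (fun y => f y + g y) x.
Proof.
move=> hf hg; apply: (holomorphic_near_derive (D := fun v y => 'D_v f y + 'D_v g y)).
apply: filterS2 hf hg => y [df cf] [dg cg]; split; first exact: differentiableD.
move=> v; split; first by apply: deriveD; exact: diff_derivable.
exact: (@cvgD R[i] W _ (nbhs y) _ ('D_v f) ('D_v g) _ _ (cf v) (cg v)).
Qed.

Lemma holomorphicN V W (f : V -> W) (x : V) :
  holomorphic_near f x -> holomorphic_near (fun y => - f y) x.
Proof.
move=> hf; apply: (holomorphic_near_derive (D := fun v y => - 'D_v f y)).
apply: filterS hf => y [df cf]; split; first exact: differentiableN.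
move=> v; split; first by apply: deriveN; exact: diff_derivable.
exact: (@cvgN R[i] W _ (nbhs y) _ ('D_v f) _ (cf v)).
Qed.

Lemma holomorphic_cst V W (c : W) (x : V) : holomorphic_near (fun _ : V => c) x.
Proof.
apply: (holomorphic_near_derive (D := fun _ _ => 0)); apply: nearW => y.
split; first exact: differentiable_cst.
by move=> v; split; [exact: derive_cst|exact: cvg_cst].
Qed.

Lemma holomorphic_linear V W (L : V -> W) (x : V) :
  (forall y, is_diff y L L) -> holomorphic_near L x.
Proof.
move=> dL; apply: (holomorphic_near_derive (D := fun v _ => L v)).
apply: nearW => y; split; first by have [] := dL y.
move=> v; split; last exact: cvg_cst.
by have [dLy Ly] := dL y; rewrite deriveE// Ly.
Qed.

(** With a linear inner map the direction [L v] does not depend on the point, so continuity of each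
    directional derivative of [f] separately is enough. *)
Lemma holomorphic_comp_linear U V W (L : U -> V) (f : V -> W) (x : U) :
  (forall y, is_diff y L L) -> holomorphic_near f (L x) ->
  holomorphic_near (fun y => f (L y)) x.
Proof.
move=> dL hf; have dLy y : differentiable L y by have [] := dL y.
have cL y : {for y, continuous L} by exact: differentiable_continuous.
apply: (holomorphic_near_derive (D := fun v y => 'D_(L v) f (L y))).
have : \forall y \near x, differentiable f (L y) /\
    forall v, {for L y, continuous (fun u => 'D_v f u)} := cL x _ hf.
apply: filterS => y [df cf]; split; first exact: differentiable_comp.
move=> v; split; last exact: (@cvg_comp _ _ _ L ('D_(L v) f) _ _ _ (cL y) (cf (L v))).
have := derive_comp v (dLy y) df; rewrite (deriveE _ (dLy y)).
by have [_ ->] := dL y.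
Qed.

Lemma linear_comp_holomorphic U V W (L : V -> W) (f : U -> V) (x : U) :
  (forall y, is_diff y L L) -> holomorphic_near f x ->
  holomorphic_near (fun y => L (f y)) x.
Proof.
move=> dL hf; have dLy y : differentiable L y by have [] := dL y.
have cL y : {for y, continuous L} by exact: differentiable_continuous.
apply: (holomorphic_near_derive (D := fun v y => L ('D_v f y))).
apply: filterS hf => y [df cf]; split; first exact: differentiable_comp.
move=> v; split; last exact: (@cvg_comp _ _ _ ('D_v f) L _ _ _ (cf v) (cL _)).
have := derive_comp v df (dLy (f y)); rewrite (deriveE _ (dLy (f y))).
by have [_ ->] := dL (f y).
Qed.

(** Here the direction ['D_v f y] varies with [y], but it is a scalar and factors out of the
    derivative of [g]. *)
Lemma holomorphic_comp_curve V W (f : V -> R[i]) (g : R[i] -> W) (x : V) :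
  holomorphic_near f x -> holomorphic_near g (f x) ->
  holomorphic_near (fun y => g (f y)) x.
Proof.
move=> hf hg; have [dfx _] := nbhs_singleton hf.
apply: (holomorphic_near_derive (D := fun v y => 'D_v f y *: 'D_1 g (f y))).
have : \forall y \near x, differentiable g (f y) /\
    forall v, {for f y, continuous (fun u => 'D_v g u)} :=
  differentiable_continuous dfx hg.
apply: filterS2 hf => y [df cf] [dg cg]; split; first exact: differentiable_comp.
move=> v; split; first by have := derive_comp v df dg; rewrite [RHS]derive_along.
apply: (@cvgZ R[i] W _ (nbhs y) _ ('D_v f) (fun u => 'D_1 g (f u))); first exact: cf.
exact: (@cvg_comp _ _ _ f ('D_1 g) _ _ _ (differentiable_continuous df) (cg 1)).
Qed.

End HolomorphicMaps.

(** * Holomorphy of the local inverse *)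

Section InverseHolomorphic.
Variable R : realType.
Implicit Types (f g : R[i] -> R[i]).

(** The difference quotient of [g] at increment [h] is the reciprocal of that of [f] at increment
    [g (h + y) - g y], which tends to 0 by continuity of [g]. *)
Lemma is_derive_inverse_at f g (y : R[i]) :
  {for y, continuous g} -> (\forall u \near y, f (g u) = u) ->
  differentiable f (g y) -> 'D_1 f (g y) != 0 ->
  is_derive y 1 g ('D_1 f (g y))^-1.
Proof.
move=> gc fg df b0; set x := g y; set b := 'D_1 f x.
pose q (k : R[i]) : R[i] := k^-1 *: (f (k *: (1 : R[i]) + x) - f x).
have qb : q @ 0^' --> b by exact: diff_derivable.
pose k (h : R[i]) : R[i] := g (h + y) - x.
have shift0 : (fun h : R[i] => h + y) @ 0 --> y.
  rewrite -[X in _ --> X]add0r.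
  by apply: (@cvgD R[i] R[i] _ (nbhs 0)); [exact: cvg_id|exact: cvg_cst].
have fgh : \forall h \near (0 : R[i]), f (g (h + y)) = h + y.
  exact: shift0 fg.
have kc : k @ 0 --> (0 : R[i]).
  suff : k @ 0 --> x - x by rewrite subrr.
  apply: (@cvgB R[i] R[i] _ (nbhs (0 : R[i])) _ (fun h => g (h + y)) (cst x));
    last exact: cvg_cst.
  exact: (@cvg_comp _ _ _ (fun h => h + y) g _ _ _ shift0 gc).
have fx : f x = y by exact: nbhs_singleton fg.
(* The increment [k h] avoids 0 when [h] does, because [f] recovers [h + y] from [g (h + y)]. *)
have kc' : k @ 0^' --> (0 : R[i])^'.
  move=> A A0; have kA : \forall h \near (0 : R[i]), k h != 0 -> A (k h) := kc _ A0.
  apply: filterS2 fgh kA => h fgh kA h0; apply: kA; apply: contra h0 => /eqP kh0.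
  move/eqP: kh0; rewrite subr_eq0 => /eqP ghx.
  by move: fgh; rewrite ghx fx => /esym/eqP; rewrite -subr_eq0 addrK.
have quotE : \forall h \near (0 : R[i])^',
    (q (k h))^-1 = h^-1 *: (g (h *: (1 : R[i]) + y) - g y).
  apply: nbhs_dnbhs; apply: filterS fgh => h fgh.
  rewrite /q /k [_ *: 1]mulr1 [h *: 1]mulr1 subrK fgh fx addrK.
  by rewrite [LHS]invfM invrK mulrC.
suff H : (fun h : R[i] => h^-1 *: (g (h *: (1 : R[i]) + y) - g y)) @ 0^' --> b^-1.
  by split; [apply/cvg_ex; eexists; exact: H | exact: cvg_lim H].
apply: cvg_trans; first exact: near_eq_cvg quotE.
apply: (@cvgV R[i] _ ((0 : R[i])^') _ (q \o k) b b0).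
exact: cvg_comp kc' qb.
Qed.

Lemma near_modulus_lt (c y : R[i]) (e : R) :
  modulus (y - c) < e -> \forall u \near y, modulus (u - c) < e.
Proof.
move=> yc; have /modulus_near : 0 < e - modulus (y - c) by rewrite subr_gt0.
move=> /(_ y); apply: filterS => u uy.
by have := modulusD (u - y) (y - c); rewrite addrA subrK; lra.
Qed.

Lemma holomorphic_local_inverse f (x0 : R[i]) :
  holomorphic_near f x0 -> 'D_1 f x0 != 0 ->
  exists g, [/\ g (f x0) = x0, holomorphic_near g (f x0),
    \forall x \near x0, g (f x) = x & \forall y \near f x0, f (g y) = y].
Proof.
move=> hf a0; have [d [d0 fd fa]] := linear_approximation hf a0.
set a := 'D_1 f x0 in a0 fa.
have ma : 0 < modulus a by rewrite modulus_gt0.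
have d5 : d <= 5 * d by lra.
have fC x : modulus (x - x0) < 5 * d -> {for x, continuous f}.
  by move=> /fd[df _ _]; exact: differentiable_continuous.
pose g := local_inverse f x0 d; pose e := modulus a * d / 4.
have e0 : 0 < e by rewrite /e; nra.
have gP y : modulus (y - f x0) < e -> modulus (g y - x0) < d /\ f (g y) = y.
  exact: local_inverseP.
have gP5 y : modulus (y - f x0) < e -> modulus (g y - x0) < 5 * d.
  by move=> /gP[? _]; lra.
have gf : \forall x \near x0, g (f x) = x.
  have fx : \forall x \near x0, modulus (f x - f x0) < e.
    have x0d : modulus (x0 - x0) < 5 * d by rewrite subrr modulus0; lra.
    exact: (fC _ x0d [set w | modulus (w - f x0) < e] (modulus_near _ e0)).
  apply: filterS2 fx (modulus_near x0 d0) => x fx xd.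
  apply: (local_injective a0 fa) (gP _ fx).2; first exact: gP5.
  exact: lt_le_trans xd d5.
(* [lower_bound] makes [g] Lipschitz with constant [2 / modulus a]. *)
have gC y : modulus (y - f x0) < e -> {for y, continuous g}.
  move=> ye; apply/(@cvgrPdist_lt _ _ _ (nbhs y)) => r.
  rewrite ltcE /= => /andP[/eqP imr r0].
  have r1 : 0 < modulus a / 2 * complex.Re r by rewrite mulr_gt0// divr_gt0.
  apply: filterS2 (near_modulus_lt ye) (modulus_near y r1) => u ue uy.
  rewrite -modulusE ltcE /= imr eqxx /=.
  have := lower_bound fa (gP5 _ ye) (gP5 _ ue).
  rewrite (gP _ ye).2 (gP _ ue).2 [leRHS]modulusC => H.
  have : modulus a / 2 * modulus (g y - g u) < modulus a / 2 * complex.Re r by lra.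
  by rewrite ltr_pM2l// divr_gt0.
have dg y : modulus (y - f x0) < e -> is_derive y 1 g ('D_1 f (g y))^-1.
  move=> ye; have [df _ Df0] := fd _ (gP5 _ ye).
  apply: is_derive_inverse_at => //; first exact: gC.
  by apply: filterS (near_modulus_lt ye) => u /gP[].
have diffg y : modulus (y - f x0) < e -> differentiable g y.
  by move=> /dg[dgy _]; exact/derivable1_diffP.
exists g; split.
- exact: nbhs_singleton gf.
- pose D (v u : R[i]) : R[i] := v *: ('D_1 f (g u))^-1.
  apply: (@holomorphic_near_derive R R[i] R[i] g D).
  apply: filterS (modulus_near (f x0) e0) => y ye.
  split; first exact: diffg.
  move=> v; have [_ cf Df0] := fd _ (gP5 _ ye); split.
    rewrite derive_along; last exact: diffg.
    by rewrite (derive_val (is_derive := dg _ ye)).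
  apply: (@cvgZl_tmp R[i] R[i] _ (nbhs y) _ v (fun u => ('D_1 f (g u))^-1)).
  apply: (@cvgV R[i] _ (nbhs y) _ (fun u => 'D_1 f (g u)) _ Df0).
  exact: (@cvg_comp _ _ _ g ('D_1 f) _ _ _ (gC _ ye) cf).
- exact: gf.
- by apply: filterS (modulus_near (f x0) e0) => y /gP[].
Qed.

End InverseHolomorphic.

(** * Orders of vanishing *)

Section OrderOfVanishing.
Variable R : realType.

Lemma ord_le (h : R[i] -> R[i]) (a b : nat) :
  taylor_coef1 h a b != 0 -> (ord h <= ((a + b)%N%:R)%:E)%E.
Proof. by move=> hab; apply: ereal_inf_lbound; exists (a, b). Qed.

Lemma ord_ge (h : R[i] -> R[i]) (m : nat) :
  (forall a b, taylor_coef1 h a b != 0 -> (m <= a + b)%N) ->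
  ((m%:R)%:E <= ord h)%E.
Proof.
move=> H; apply: le_ereal_inf_tmp => _ [[a b] /= hab <-].
by rewrite lee_fin ler_nat H.
Qed.

(** The infimum runs over a set of natural numbers, so it is attained as soon as the set is
    nonempty. *)
Lemma ord_cases (h : R[i] -> R[i]) :
  ord h = +oo%E \/
  exists a b, taylor_coef1 h a b != 0 /\ ord h = ((a + b)%N%:R)%:E.
Proof.
have [[[a0 b0] hab0]|hno] :=
  pselect (exists ab, taylor_coef1 h ab.1 ab.2 != 0); last first.
  left; rewrite /ord (_ : [set _ | _ in _] = set0) ?ereal_inf0//.
  by rewrite -subset0 => x [ab hab _]; apply: hno; exists ab.
right; pose P m := `[< exists ab, taylor_coef1 h ab.1 ab.2 != 0 /\ (ab.1 + ab.2)%N = m >].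
have exP : exists m, P m by exists (a0 + b0)%N; apply/asboolP; exists (a0, b0).
case: (ex_minnP exP) => m /asboolP[[a b] /= [hab abm]] minm.
exists a, b; split => //; apply/eqP; rewrite eq_le ord_le//= abm.
by apply: ord_ge => c d hcd; apply: minm; apply/asboolP; exists (c, d).
Qed.

Lemma taylor_coef1_00 (h : R[i] -> R[i]) : taylor_coef1 h 0 0 = h 0.
Proof. by rewrite /taylor_coef1 /= divr1. Qed.

Lemma taylor_coef1_10 (h : R[i] -> R[i]) :
  differentiable h 0 -> taylor_coef1 h 1 0 = 'D_1 h 0.
Proof. by move=> dh; rewrite /taylor_coef1 /= divr1 wirtinger_holomorphic. Qed.

Lemma taylor_coef1_01 (h : R[i] -> R[i]) :
  differentiable h 0 -> taylor_coef1 h 0 1 = 0.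
Proof. by move=> dh; rewrite /taylor_coef1 /= divr1 wirtinger_bar_holomorphic. Qed.

(** The constant terms vanish by [h 0 = 0] and the coefficients of the conjugate variable by complex
    differentiability, so the derivatives at 0 are the only possible terms of degree below 2. *)
Lemma vord1P (n : nat) (h : R[i] -> 'rV[R[i]]_n) :
  differentiable h 0 -> h 0 = 0 ->
  vord h = 1%E <-> exists k, 'D_1 (fun t => h t 0 k) 0 != 0.
Proof.
move=> dh h0.
have dhk k : differentiable (fun t => h t 0 k) 0.
  exact: (@differentiable_comp _ _ _ _ h (fun y : 'rV[R[i]]_n => y 0 k) 0 dh
    (differentiable_coord _ _ _)).
have c00 k : taylor_coef1 (fun t => h t 0 k) 0 0 = 0.
  by rewrite taylor_coef1_00 h0 mxE.
split=> [h1|[k hk]].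
  apply/not_existsP => D0.
  have : ((2%:R : R)%:E <= vord h)%E.
    apply: le_ereal_inf_tmp => _ [k _ <-]; apply: ord_ge => a b.
    case: a b => [|[|a]] [|[|b]] //.
    - by rewrite c00 eqxx.
    - by rewrite taylor_coef1_01// eqxx.
    - by rewrite taylor_coef1_10// => /D0.
  by rewrite h1 lee_fin (ler_nat _ 2 1).
apply/eqP; rewrite eq_le; apply/andP; split.
  apply: (@le_trans _ _ (ord (fun t => h t 0 k))).
    by apply: ereal_inf_lbound; exists k.
  by apply: (@ord_le _ 1 0); rewrite taylor_coef1_10.
apply: le_ereal_inf_tmp => _ [j _ <-]; apply: (@ord_ge _ 1) => a b.
by case: a b => [|a] [|b] //; rewrite c00 eqxx.
Qed.

End OrderOfVanishing.

(** * Regular curves and holomorphic coordinates *)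

Section Coordinates.
Variables (R : realType) (n : nat).
Notation Cn := 'rV[R[i]]_n.
Implicit Types (p : Cn) (g : R[i] -> Cn) (z w : Cn -> Cn).

Lemma derive_coord g (k : 'I_n) (t v : R[i]) :
  differentiable g t -> 'D_v (fun s => g s 0 k) t = ('D_v g t) 0 k.
Proof.
move=> dg; have [dk k_eq] := is_diff_coord k (g t).
by have := derive_comp v dg dk; rewrite (deriveE _ dk) k_eq.
Qed.

Lemma regularP p g :
  holomorphic_curves p g ->
  regular_curves p g <-> exists k, 'D_1 (fun t => g t 0 k) 0 != 0.
Proof.
move=> hg; have [/nbhs_singleton[dg _] g0 _] := hg.
have dgp : differentiable (fun t => g t - p) 0.
  by apply: differentiableB => //; exact: differentiable_cst.
have DE k : 'D_1 (fun t => (g t - p) 0 k) 0 = 'D_1 (fun t => g t 0 k) 0.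
  have E : 'D_1 (fun t => g t - p) 0 = 'D_1 g 0.
    have := @deriveB _ _ _ g (cst p) 0 1 (diff_derivable dg) (derivable_cst _ _ _).
    by rewrite derive_cst subr0.
  apply: (etrans (derive_coord k 1 dgp)); apply: (etrans _ (esym (derive_coord k 1 dg))).
  exact: (f_equal (fun M : Cn => M 0 k) E).
have gp0 : g 0 - p = 0 by rewrite g0 subrr.
have [V1 V2] := vord1P dgp gp0.
split=> [[_ /V1[k Dk]]|[k Dk]]; first by exists k; rewrite -DE.
by split; [exact: hg|apply: V2; exists k; rewrite DE].
Qed.

Lemma is_diff_axis (e : Cn) (t : R[i]) :
  is_diff t (fun s : R[i] => s *: e) (fun s : R[i] => s *: e).
Proof. exact: is_diff_scalel. Qed.

(** By the chain rule [z] sends the velocity of the curve at 0 to [basis_vec R j], so this velocity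
    is nonzero. *)
Lemma axis_regular p z w (j : 'I_n) :
  holomorphic_coordinate p z w ->
  regular_curves p (fun t => w (t *: basis_vec R j)).
Proof.
move=> [[zp w0] hz hw wz zw].
pose ax (t : R[i]) : Cn := t *: basis_vec R j.
have dax (t : R[i]) : is_diff t ax ax by exact: is_diff_axis.
have ax0 : ax 0 = 0 by rewrite /ax scale0r.
pose g (t : R[i]) : Cn := w (ax t).
have g0 : g 0 = p by rewrite /g ax0.
have hw0 : holomorphic_near w (ax 0) by rewrite ax0.
have hg : holomorphic_near g 0 by exact: holomorphic_comp_linear dax hw0.
have zg : \forall t \near (0 : R[i]), z (g t) = ax t.
  have [dax0 _] := dax 0; have axc := differentiable_continuous dax0.
  by rewrite -ax0 in zw; exact: (axc [set y | z (w y) = y] zw).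
have [dg _] := nbhs_singleton hg.
have dz : differentiable z (g 0) by rewrite g0; have [] := nbhs_singleton hz.
have Dg : 'D_1 g 0 != 0.
  apply/eqP => Dg0.
  have : 'D_1 (z \o g) 0 = basis_vec R j.
    rewrite (near_eq_derive _ zg) deriveE; last by have [] := dax 0.
    by have [_ ->] := dax 0; rewrite /ax scale1r.
  rewrite derive_comp// Dg0 derive0 => /rowP/(_ j); rewrite !mxE !eqxx /= => /esym/eqP.
  by rewrite oner_eq0.
have [k Dgk] : exists k, 'D_1 (fun t => g t 0 k) 0 != 0.
  apply/not_existsP => D0; case/eqP: Dg; apply/rowP => k.
  by rewrite mxE -derive_coord//; apply/eqP/negPn/negP/D0.
apply/regularP; last by exists k.
(* A curve equal to [p] near 0 would have zero velocity. *)
split => // gp; case/eqP: Dg.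
by rewrite (near_eq_derive _ gp) derive_cst.
Qed.

(** The [k]-th coordinate of [w y] is [g_k(y_k)], from which the one-variable inverse [phi] recovers
    [y_k]; the remaining shift [G(y_k)] is then subtracted. On the axis [w] agrees with [g] for
    every [t], as the linear parts cancel. *)
Lemma straightening g (k : 'I_n) :
  holomorphic_near g 0 -> 'D_1 (fun t => g t 0 k) 0 != 0 ->
  exists z w, holomorphic_coordinate (g 0) z w /\
    forall t, w (t *: basis_vec R k) = g t.
Proof.
move=> hg Dk; have [dg _] := nbhs_singleton hg.
have hgk : holomorphic_near (fun t => g t 0 k) 0.
  apply: (@linear_comp_holomorphic _ _ _ _ (fun x : Cn => x 0 k)); last exact: hg.
  exact: is_diff_coord.
have [phi [phi0 hphi phig gphi]] := holomorphic_local_inverse hgk Dk.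
pose ax (t : R[i]) : Cn := t *: basis_vec R k.
have dax (t : R[i]) : is_diff t ax ax by exact: is_diff_axis.
have ax0 : ax 0 = 0 by rewrite /ax scale0r.
have axk t : ax t 0 k = t by rewrite /ax !mxE !eqxx mulr1.
have addk (a b : Cn) : (a + b) 0 k = a 0 k + b 0 k by rewrite mxE.
have subk (a b : Cn) : (a - b) 0 k = a 0 k - b 0 k by rewrite !mxE.
pose G t := g t - ax t.
have hNax : holomorphic_near (fun t => - ax t) 0.
  exact/holomorphicN/holomorphic_linear.
have hG : holomorphic_near G 0 by exact: holomorphicD hg hNax.
have Gk t : G t 0 k = g t 0 k - t by rewrite /G subk axk.
pose pr (x : Cn) := x 0 k.
have dpr (x : Cn) : is_diff x pr pr by exact: is_diff_coord.
have hid (x : Cn) : holomorphic_near id x.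
  by apply: holomorphic_linear => y; exact: is_diff_id.
have cpr (x : Cn) : {for x, continuous pr} by exact: coord_continuous.
have pr0 : pr 0 = 0 by rewrite /pr mxE.
pose z (x : Cn) := x - G (phi (pr x)).
pose w (y : Cn) := y + G (pr y).
exists z, w.
split; last by move=> t; rewrite /w /pr axk /G addrC subrK.
have G0 : G 0 = g 0 by rewrite /G ax0 subr0.
have hGphi : holomorphic_near (fun s => G (phi s)) (pr (g 0)).
  by apply: holomorphic_comp_curve; rewrite /pr ?phi0; [exact: hphi|exact: hG].
have hz : holomorphic_near z (g 0).
  exact: holomorphicD (hid _) (holomorphicN (holomorphic_comp_linear dpr hGphi)).
have hw : holomorphic_near w 0.
  have hG0 : holomorphic_near G (pr 0) by rewrite pr0; exact: hG.
  have hGpr : holomorphic_near (fun y => G (pr y)) 0 := holomorphic_comp_linear dpr hG0.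
  exact: holomorphicD (hid 0) hGpr.
split; [|exact: hz|exact: hw| |].
- by rewrite /z /w /pr phi0 G0 subrr -/(pr 0) pr0 G0 add0r.
- have : \forall x \near g 0, g (phi (pr x)) 0 k = pr x :=
    cpr (g 0) [set s | g (phi s) 0 k = s] gphi.
  apply: filterS => x gx.
  have prz : pr (z x) = phi (pr x).
    by rewrite /z {1}/pr subk Gk gx opprB addrC subrK.
  by rewrite /w prz /z subrK.
- have : \forall y \near (0 : Cn), phi (g (pr y) 0 k) = pr y.
    by rewrite -pr0 in phig; exact: (cpr 0 [set t | phi (g t 0 k) = t] phig).
  apply: filterS => y py.
  have prw : pr (w y) = g (pr y) 0 k by rewrite /w {1}/pr addk Gk addrC subrK.
  by rewrite /z prw py /w addrK.
Qed.

End Coordinates.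

(** * The Newton polyhedron on the coordinate axes *)

Section NewtonPolyhedron.
Variables (R : realType) (n : nat).
Notation Cn := 'rV[R[i]]_n.
Implicit Types (F : Cn -> R[i]) (j : 'I_n).

Definition axis_restriction F j (t : R[i]) : R[i] := F (t *: basis_vec R j).

Lemma real_line_axis j (t v : R[i]) (s : R) :
  real_line t v s *: basis_vec R j =
  real_line (t *: basis_vec R j) (v *: basis_vec R j) s.
Proof. by rewrite /real_line scalerDl scalerA. Qed.

Lemma rderiv_axis (f : Cn -> R) j (t v : R[i]) :
  rderiv v (fun s : R[i] => f (s *: basis_vec R j)) t =
  rderiv (v *: basis_vec R j) f (t *: basis_vec R j).
Proof.
rewrite /rderiv; congr (derive1 _ 0); apply/funext => s /=.
by rewrite real_line_axis.
Qed.

Lemma cderiv_axis F j (t v : R[i]) :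
  cderiv v (axis_restriction F j) t =
  cderiv (v *: basis_vec R j) F (t *: basis_vec R j).
Proof.
rewrite /cderiv.
by rewrite (rderiv_axis (fun x => complex.Re (F x)))
  (rderiv_axis (fun x => complex.Im (F x))).
Qed.

(** The map [t *: basis_vec R j] carries real lines to real lines, so the two sides are equal as
    functions and the identity can be iterated. *)
Lemma wirtinger_axis F j :
  wirtinger (1 : R[i]) (axis_restriction F j) =
  axis_restriction (wirtinger (basis_vec R j) F) j.
Proof.
apply/funext => t; rewrite /wirtinger !cderiv_axis scale1r.
by rewrite [_ *: (1 : R[i])]mulr1.
Qed.

Lemma wirtinger_bar_axis F j :
  wirtinger_bar (1 : R[i]) (axis_restriction F j) =
  axis_restriction (wirtinger_bar (basis_vec R j) F) j.
Proof.
apply/funext => t; rewrite /wirtinger_bar !cderiv_axis scale1r.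
by rewrite [_ *: (1 : R[i])]mulr1.
Qed.

Lemma iter_wirtinger_axis F j (a b : nat) :
  iter a (wirtinger (1 : R[i]))
    (iter b (wirtinger_bar (1 : R[i])) (axis_restriction F j)) =
  axis_restriction (iter a (wirtinger (basis_vec R j))
    (iter b (wirtinger_bar (basis_vec R j)) F)) j.
Proof.
have -> : iter b (wirtinger_bar (1 : R[i])) (axis_restriction F j) =
    axis_restriction (iter b (wirtinger_bar (basis_vec R j)) F) j.
  by elim: b => //= b ->; rewrite wirtinger_bar_axis.
by elim: a => //= a ->; rewrite wirtinger_axis.
Qed.

Definition axis_index j (a : nat) : 'I_n -> nat := fun i => if i == j then a else 0.

Lemma foldr_axis_index j (a : nat) (D : 'I_n -> (Cn -> R[i]) -> Cn -> R[i]) F :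
  foldr (fun i g => iter (axis_index j a i) (D i) g) F (enum 'I_n) = iter a (D j) F.
Proof.
have H s : uniq s -> foldr (fun i g => iter (axis_index j a i) (D i) g) F s =
    if j \in s then iter a (D j) F else F.
  elim: s => //= i s IH /andP[is_ us]; rewrite IH// in_cons /axis_index.
  by have [<-|] := eqVneq i j; rewrite ?(negbTE is_).
by rewrite H ?enum_uniq// mem_enum.
Qed.

(** Exponents off the [j]-th slot are 0: they contribute no derivative and a factorial equal to
    1. *)
Lemma taylor_coef_axis F j (a b : nat) :
  taylor_coef F (axis_index j a) (axis_index j b) =
  taylor_coef1 (axis_restriction F j) a b.
Proof.
rewrite /taylor_coef /taylor_coef1 !foldr_axis_index iter_wirtinger_axis.
rewrite /axis_restriction scale0r; congr (_ / _%:R).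
rewrite (bigD1 j)//= /axis_index eqxx big1 ?muln1// => i /negbTE ->.
by rewrite fact0.
Qed.

(** The polyhedron is the smallest convex set containing the generating orthants, so the forward
    direction exhibits a convex set [S] that contains them and satisfies the claim on the axis. *)
Lemma newton_axisP F j (x : R) :
  newton_polyhedron F (axis_pt j x) <->
  exists a b, taylor_coef1 (axis_restriction F j) a b != 0 /\ (a + b)%:R <= x.
Proof.
have ptj : (axis_pt j x) 0 j = x by rewrite !mxE !eqxx mulr1.
have pti i : i != j -> (axis_pt j x) 0 i = 0.
  by move=> ij; rewrite !mxE eqxx (negbTE ij) mulr0.
split; last first.
  move=> [a [b [cab abx]]]; apply: sub_gen_smallest => /=.
  exists (axis_index j a), (axis_index j b); rewrite taylor_coef_axis.
  split => // i; rewrite /axis_index; have [->|ij] := eqVneq i j; first by rewrite ptj.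
  by rewrite pti.
(* S is convex because a proper convex combination of points of the orthant
   lies on an axis only if both points do. *)
pose S := [set xi : 'rV[R]_n | (forall i, 0 <= xi 0 i) /\
  ((forall i, i != j -> xi 0 i = 0) ->
    exists a b, taylor_coef1 (axis_restriction F j) a b != 0 /\ (a + b)%:R <= xi 0 j)].
suff NS : newton_polyhedron F `<=` S.
  by move=> /NS[_ /(_ pti)]; rewrite ptj.
apply: smallest_sub.
  apply/convex_setW => u v /[!inE] -[u0 uS] [v0 vS] k k0 k1; rewrite inE.
  pose l : R := k%:num; have l0 : 0 < l by []; have l1 : 0 < 1 - l by rewrite subr_gt0.
  have E i : (conv k u v : 'rV[R]_n) 0 i = l * u 0 i + (1 - l) * v 0 i.
    by rewrite !mxE.
  split=> [i|Z]; first by rewrite E; have := u0 i; have := v0 i; nra.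
  have uvZ i : i != j -> u 0 i = 0 /\ v 0 i = 0.
    move=> /Z; rewrite E => /eqP.
    rewrite paddr_eq0 ?mulr_ge0// ?ltW//.
    by rewrite !mulf_eq0 (gt_eqF l0) (gt_eqF l1) /= => /andP[/eqP -> /eqP ->].
  have [a [b [cab abu]]] := uS (fun i ij => (uvZ i ij).1).
  have [c [d [ccd cdv]]] := vS (fun i ij => (uvZ i ij).2).
  (* The point with the smaller [j]-th coordinate provides the exponents, since a convex combination
     is at least the minimum. *)
  rewrite E; have [uv|/ltW vu] := leP (u 0 j) (v 0 j).
    by exists a, b; split => //; nra.
  by exists c, d; split => //; nra.
move=> xi [alpha [beta [cab abxi]]]; split=> [i|Z].
  exact: le_trans (ler0n _ _) (abxi i).
have Z0 i : i != j -> alpha i = 0 /\ beta i = 0.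
  move=> ij; have := abxi i; rewrite (Z i ij) lern0 addn_eq0.
  by move=> /andP[/eqP -> /eqP ->].
have aE : alpha = axis_index j (alpha j).
  by apply/funext => i; rewrite /axis_index; case: eqVneq => [->//|/Z0[]].
have bE : beta = axis_index j (beta j).
  by apply/funext => i; rewrite /axis_index; case: eqVneq => [->//|/Z0[]].
exists (alpha j), (beta j); rewrite -taylor_coef_axis -aE -bE; split=> //.
Qed.

(** [F 0 = 0] makes the order positive, so a finite order is itself admissible in the infimum, which
    only runs over [0 < x]. *)
Lemma rho_axis F j : F 0 = 0 -> rho F j = ord (axis_restriction F j).
Proof.
move=> F0; apply/eqP; rewrite eq_le; apply/andP; split; last first.
  apply: le_ereal_inf_tmp => _ [x [x0 /newton_axisP[a [b [cab abx]]]] <-].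
  by apply: le_trans (ord_le cab) _; rewrite lee_fin.
have [->|[a [b [cab ->]]]] := ord_cases (axis_restriction F j); first exact: leey.
apply: ereal_inf_lbound; exists (a + b)%:R => //; split.
  rewrite ltr0n lt0n addn_eq0; apply: contra cab => /andP[/eqP -> /eqP ->].
  by rewrite taylor_coef1_00 /axis_restriction scale0r F0.
by apply/newton_axisP; exists a, b.
Qed.

Lemma max_rho_axis F : F 0 = 0 ->
  (forall j, (ord (axis_restriction F j) < +oo)%E) ->
  max_rho F = \big[maxe/-oo%E]_(j < n) ord (axis_restriction F j).
Proof.
move=> F0 Ffin; rewrite /max_rho asboolT.
  by apply: eq_bigr => j _; exact: rho_axis.
move=> j; have := Ffin j.
have [->|[a [b [cab _]]] _] := ord_cases (axis_restriction F j); first by rewrite ltxx.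
by exists (a + b)%:R; apply/newton_axisP; exists a, b.
Qed.

End NewtonPolyhedron.

(** * Comparison of the two types with [rho1] *)

Section Types.
Variables (R : realType) (n : nat).
Notation Cn := 'rV[R[i]]_n.
Implicit Types (p : Cn) (r : Cn -> R) (g : R[i] -> Cn) (z w : Cn -> Cn).

Lemma contact_axis r w (j : 'I_n) :
  ord (axis_restriction (fun y => (r (w y))%:C) j) =
  contact r (fun t => w (t *: basis_vec R j)).
Proof. by []. Qed.

Lemma le_regular_type r p g :
  regular_curves p g -> (contact r g <= regular_type r p)%E.
Proof. by move=> gp; apply: ereal_sup_ubound; exists g. Qed.

Lemma regular_le_singular r p : (regular_type r p <= singular_type r p)%E.
Proof.
apply: ge_ereal_sup => _ [g [gp g1] <-]; apply: ereal_sup_ubound.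
by exists g => //; rewrite g1 inve1 mule1.
Qed.

(** The axes are regular curves, so a finite regular type bounds their contacts; this is what makes
    [r] convenient in the coordinate. *)
Lemma rho1_axis r p z w :
  r p = 0 -> (regular_type r p < +oo)%E -> holomorphic_coordinate p z w ->
  rho1 r w = \big[maxe/-oo%E]_(j < n) contact r (fun t => w (t *: basis_vec R j)).
Proof.
move=> rp fin hzw; have [[_ w0] _ _ _ _] := hzw.
rewrite /rho1 max_rho_axis ?w0 ?rp// => j.
apply: le_lt_trans fin; rewrite contact_axis.
exact: le_regular_type (axis_regular j hzw).
Qed.

Lemma rho1_le_regular r p z w :
  r p = 0 -> (regular_type r p < +oo)%E -> holomorphic_coordinate p z w ->
  (rho1 r w <= regular_type r p)%E.
Proof.
move=> rp fin hzw; rewrite (rho1_axis rp fin hzw).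
apply: bigmax_le => [|j _]; first exact: leNye.
exact: le_regular_type (axis_regular j hzw).
Qed.

Lemma translation_coordinate p :
  holomorphic_coordinate p (fun x => x - p) (fun y => y + p).
Proof.
have hid (x : Cn) : holomorphic_near id x.
  by apply: holomorphic_linear => y; exact: is_diff_id.
split.
- by rewrite subrr add0r.
- exact: holomorphicD (hid p) (holomorphic_cst (- p) p).
- exact: holomorphicD (hid 0) (holomorphic_cst p 0).
- by apply: (@nearW _ (nbhs p)) => x; rewrite subrK.
- by apply: (@nearW _ (nbhs (0 : Cn))) => y; rewrite addrK.
Qed.

Lemma contact_ge0 r g : (0 <= contact r g)%E.
Proof. exact: (@ord_ge _ _ 0). Qed.

(** Finite contacts are natural numbers, and a nonempty bounded set of naturals has a maximum. The
    index [k] provides one regular curve, an axis of the translated coordinate. *)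
Lemma regular_type_attained r p (k : 'I_n) :
  (regular_type r p < +oo)%E ->
  exists2 g, regular_curves p g & contact r g = regular_type r p.
Proof.
move=> fin.
have reg0 := axis_regular k (translation_coordinate p); set g0 := fun t => _ in reg0.
have natE g : regular_curves p g -> exists m : nat, contact r g = (m%:R)%:E.
  move=> hg; have [E|[a [b [_ E]]]] := ord_cases (fun t => (r (g t))%:C).
    by have := le_lt_trans (le_regular_type r hg) fin; rewrite /contact E ltxx.
  by exists (a + b)%N.
pose P m := `[< exists2 g, regular_curves p g & contact r g = (m%:R)%:E >].
have exP : exists m, P m.
  by have [m mE] := natE _ reg0; exists m; apply/asboolP; exists g0.
(* The nonnegative contact of [g0] excludes the value [-oo]; the real value is rounded up to a
   natural bound. *)
have [N regN] : exists N : nat, (regular_type r p <= (N%:R)%:E)%E.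
  have := le_trans (contact_ge0 r g0) (le_regular_type r reg0).
  case: (regular_type r p) fin => [x _ _| |] //.
  by exists (Num.truncn x).+1; rewrite lee_fin ltW// truncnS_gt.
have leN m : P m -> (m <= N)%N.
  move=> /asboolP[g gp gm]; rewrite -(ler_nat R) -lee_fin -gm.
  exact: le_trans (le_regular_type r gp) regN.
case: (ex_maxnP exP leN) => m /asboolP[g gp gm] maxm; exists g => //.
apply/eqP; rewrite eq_le le_regular_type//=.
apply: ge_ereal_sup => _ [h hp <-]; have [l lE] := natE _ hp.
by rewrite gm lE lee_fin ler_nat maxm//; apply/asboolP; exists h.
Qed.

End Types.

Theorem theorem1p1 (R : realType) (n : nat) (M : set 'rV[R[i]]_n)
    (p : 'rV[R[i]]_n) (r : 'rV[R[i]]_n -> R)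
    (hM : real_hypersurface M) (pM : M p) (hr : local_defining M p r)
    (fin_reg : (regular_type r p < +oo)%E) :
  singular_type r p = regular_type r p <->
  exists z w : 'rV[R[i]]_n -> 'rV[R[i]]_n,
    holomorphic_coordinate p z w /\ singular_type r p = rho1 r w.
Proof.
have [_ /nbhs_singleton Mr /nbhs_singleton dr] := hr.
have rp : r p = 0 by exact/Mr.
(* The direction of a nonzero derivative of [r] at [p] supplies an index, so [n] is positive. *)
have [[k _] _] := dr rp.
split=> [->|[z [w [hzw E]]]]; last first.
  apply/eqP; rewrite eq_le regular_le_singular andbT E.
  exact: rho1_le_regular rp fin_reg hzw.
have [g gp gmax] := regular_type_attained k fin_reg.
have [hg _] := gp; have [i Dg] := (regularP hg).1 gp; have [hol_g g0 _] := hg.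
have [z [w [hzw wg]]] := straightening hol_g Dg; rewrite g0 in hzw.
exists z, w; split; first exact: hzw.
apply/eqP; rewrite eq_le (rho1_le_regular rp fin_reg hzw) andbT.
rewrite (rho1_axis rp fin_reg hzw) -gmax.
(* The maximal curve [g] is the [i]-th axis of the new coordinate, so its contact is one of the
   terms of the maximum. *)
have -> : g = (fun t => w (t *: basis_vec R i)) by apply/funext => t; rewrite wg.
exact: (le_bigmax _ (fun j => contact r (fun t => w (t *: basis_vec R j)))).
Qed.
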